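(* Let $(X,d)$ be an $\mathcal{F}$-metric space, equipped with its $\mathcal{F}$-metric topology $\tau_{\mathcal{F}}$. Then $(X,\tau_{\mathcal{F}})$ is a Hausdorff topological space.
   Context: Let $\mathcal{F}$ be the set of functions $f:[0,\infty)\to\mathbb{R}$ such that: ($\mathcal{F}_1$) $f$ is non-decreasing, i.e. $0<s<t\Rightarrow f(s)\le f(t)$; ($\mathcal{F}_2$) for every sequence $\{t_n\}\subseteq(0,\infty)$, $\lim_{n\to\infty}t_n=0 \iff \lim_{n\to\infty}f(t_n)=-\infty$. Let $X$ be a non-empty set and $d:X\times X\to[0,\infty)$ a map. Then $d$ is an $\mathcal{F}$-metric on $X$, and $(X,d)$ is an $\mathcal{F}$-metric space, if there exists $(f,\alpha)\in\mathcal{F}\times[0,\infty)$ such that: (D1) for all $x,y\in X$, $d(x,y)=0\iff x=y$; (D2) $d(x,y)=d(y,x)$ for all $x,y\in X$; (D3) for every $(x,y)\in X\times X$, every $N\in\mathbb{N}$ with $N\ge 2$, and every $(u_i)_{i=1}^N\subseteq X$ with $(u_1,u_N)=(x,y)$, we have $d(x,y)>0\Rightarrow f(d(x,y))\le f\big(\sum_{i=1}^{N-1}d(u_i,u_{i+1})\big)+\alpha$. For $x\in X$ and $r>0$ put $B(x,r)=\{y\in X: d(x,y)<r\}$. A set $U\subseteq X$ is $\mathcal{F}$-open if for every $x\in U$ there is $r>0$ with $B(x,r)\subseteq U$; the $\mathcal{F}$-open sets form the topology $\tau_{\mathcal{F}}$ on $X$. *)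

(* Defs.v *)
From HB Require Import structures.
From mathcomp Require Import all_boot all_order all_algebra.
From mathcomp Require Import all_classical all_reals all_analysis.

Set Implicit Arguments.
Unset Strict Implicit.
Unset Printing Implicit Defensive.
Import Order.TTheory GRing.Theory Num.Theory.
Import numFieldNormedType.Exports.
Local Open Scope classical_set_scope.
Local Open Scope ring_scope.

(* A function [0, +oo[ -> R is represented by a total function on R, of which
   only the values on [0, +oo[ are ever constrained or used. *)
Record Fclass (R : realType) (f : R -> R) : Prop := {
  Fclass_ndecr : forall s t : R, 0 < s -> s < t -> f s <= f t ;
  Fclass_cvg : forall t : nat -> R, (forall n, 0 < t n) ->
    (t n @[n --> \oo] --> (0 : R)) <-> (f (t n) @[n --> \oo] --> -oo) }.

(* A finite sequence u_1, ..., u_N is given by u : nat -> X; the values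
   outside of 1, ..., N play no role. *)
Definition Fchain_ineq (R : realType) (X : Type) (d : X -> X -> R)
    (f : R -> R) (alpha : R) : Prop :=
  forall (x y : X) (N : nat) (u : nat -> X), (2 <= N)%N ->
    u 1%N = x -> u N = y -> 0 < d x y ->
    f (d x y) <= f (\sum_(1 <= i < N) d (u i) (u i.+1)) + alpha.

Record is_Fmetric (R : realType) (X : Type) (d : X -> X -> R) : Prop := {
  Fmetric_ge0 : forall x y, 0 <= d x y ;
  Fmetric_gen : exists (f : R -> R) (alpha : R),
    [/\ Fclass f /\ 0 <= alpha,
        (forall x y, d x y = 0 <-> x = y),
        (forall x y, d x y = d y x) &
        Fchain_ineq d f alpha] }.

Definition Fball (R : realType) (X : Type) (d : X -> X -> R) (x : X) (r : R)
  : set X := [set y | d x y < r].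

Definition Fopen (R : realType) (X : Type) (d : X -> X -> R) : set_system X :=
  [set U | forall x, U x -> exists2 r : R, 0 < r & Fball d x r `<=` U].

(* The carrier X with the topology of F-open sets of d; the axioms of a
   topology hold for every d. *)
Definition Fspace (R : realType) (X : Type) (d : X -> X -> R) : Type := X.

Section Fspace_topology.
Context (R : realType) (X : Type) (d : X -> X -> R).

Lemma FopenT : Fopen d setT.
Proof. by move=> x _; exists 1. Qed.

Lemma FopenI : setI_closed (Fopen d).
Proof.
move=> A B oA oB x [/oA[r r0 rA] /oB[s s0 sB]].
exists (Num.min r s); first by rewrite lt_min r0.
by move=> y; rewrite /Fball /= lt_min => /andP[/rA Ay /sB By].
Qed.

Lemma Fopen_bigU (I : Type) (F : I -> set X) :
  (forall i, Fopen d (F i)) -> Fopen d (\bigcup_i F i).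
Proof.
move=> oF x [i _ /(oF i)[r r0 rF]].
by exists r => // y /rF Fy; exists i.
Qed.

HB.instance Definition _ := gen_eqMixin (Fspace d).
HB.instance Definition _ := gen_choiceMixin (Fspace d).
HB.instance Definition _ :=
  isOpenTopological.Build (Fspace d) FopenT FopenI Fopen_bigU.

Lemma open_FspaceE : @open (Fspace d) = Fopen d.
Proof. by []. Qed.

End Fspace_topology.

(* Main.v *)
(* Idea: F-balls need not be F-open, so distinct points are separated by balls
   of the chain pseudometric (infimum of the d-lengths of chains), which are
   F-open because a chain can always be prolonged by one more step.  By (D3)
   and (F2), the lengths of the chains between two distinct points are bounded
   below by some delta > 0; hence the chain balls of radius delta / 2 around
   them are disjoint. *)
Require Import Defs.
From mathcomp Require Import all_boot all_order all_algebra.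
From mathcomp Require Import all_classical all_reals all_analysis.
Import Order.TTheory GRing.Theory Num.Theory.
Import numFieldNormedType.Exports.
Local Open Scope classical_set_scope.
Local Open Scope ring_scope.

(** The length is an index of the relation, so chain balls are defined without forming an
    infimum. *)
Inductive chain {R : realType} {X : Type} (d : X -> X -> R) (x : X) :
  X -> R -> Prop :=
| chain_nil : chain d x x 0
| chain_rcons y z s : chain d x y s -> chain d x z (s + d y z).

Lemma chain_trans {R : realType} {X : Type} (d : X -> X -> R) x y z s t :
  chain d x y s -> chain d y z t -> chain d x z (s + t).
Proof.
move=> xy; elim=> [|w v u _ IH]; first by rewrite addr0.
by rewrite addrA; exact: chain_rcons.
Qed.

Lemma chain1 {R : realType} {X : Type} (d : X -> X -> R) x y :
  chain d x y (d x y).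
Proof. by rewrite -[d x y]add0r; apply/chain_rcons/chain_nil. Qed.

Lemma chain_sum {R : realType} {X : Type} (d : X -> X -> R) x y s :
  chain d x y s -> exists (n : nat) (u : nat -> X),
    [/\ u 1%N = x, u n.+1 = y & s = \sum_(1 <= i < n.+1) d (u i) (u i.+1)].
Proof.
elim=> [|{s}y' z s _ [n [u [u1 un ->]]]].
  by exists 0%N, (fun=> x); rewrite big_geq.
(* The old points keep the indices 1 to [n.+1]; the new endpoint [z] gets [n.+2]. *)
exists n.+1, (fun i => if (i <= n.+1)%N then u i else z).
split=> //; first by rewrite ltnn.
rewrite [RHS]big_nat_recr//= ltnn leqnn un; congr (_ + _).
by apply: eq_big_nat => i /andP[_ lein]; rewrite lein ltnW.
Qed.

Lemma chain_ge0 {R : realType} {X : Type} (d : X -> X -> R) x y s :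
  (forall x y, 0 <= d x y) -> chain d x y s -> 0 <= s.
Proof. by move=> d0; elim=> // *; rewrite addr_ge0. Qed.

Lemma chain_eq0 {R : realType} {X : Type} (d : X -> X -> R) x y s :
  (forall x y, 0 <= d x y) -> (forall x y, d x y = 0 -> x = y) ->
  chain d x y s -> s = 0 -> x = y.
Proof.
move=> d0 dE; elim=> // {s}y' z s xy IH /eqP.
by rewrite paddr_eq0 ?(chain_ge0 _ _ _ _ d0 xy)// => /andP[/eqP/IH -> /eqP/dE].
Qed.

(** Along the harmonic sequence [f] tends to -oo, so it is below [M] at some term; monotonicity
    carries this bound to all smaller positive arguments. *)
Lemma Fclass_small {R : realType} (f : R -> R) (M : R) : Fclass f ->
  exists2 delta, 0 < delta & forall s, 0 < s -> s < delta -> f s < M.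
Proof.
move=> Ff; have h0 n : 0 < harmonic n :> R by rewrite /harmonic /= invr_gt0.
have /cvgrNy_lt/(_ M)[n _ /(_ n (leqnn n)) /= fM] :=
  (Fclass_cvg Ff h0).1 cvg_harmonic.
exists (harmonic n) => // s s0 sn.
exact: le_lt_trans (Fclass_ndecr Ff s0 sn) fM.
Qed.

Lemma Fmetric_chain_lb {R : realType} {X : Type} (d : X -> X -> R) x y :
  is_Fmetric d -> x <> y ->
  exists2 delta, 0 < delta & forall s, chain d x y s -> delta <= s.
Proof.
move=> [d0 [f [alpha [[Ff _] dE _ D3]]]] xy.
(* With this threshold, a chain of length [s] in (0, [delta]) has [f s + alpha < f (d x y)], against
   (D3). *)
have [delta delta0 fdelta] := Fclass_small f (f (d x y) - alpha) Ff.
exists delta => // s cs; rewrite leNgt; apply/negP => sdelta.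
have dxy : 0 < d x y by rewrite lt0r d0 andbT; apply/eqP => /dE.
(* [fdelta] covers positive lengths; length 0 would force [x = y]. *)
have s0 : 0 < s.
  rewrite lt0r (chain_ge0 _ _ _ _ d0 cs) andbT; apply/eqP => s0.
  exact: xy (chain_eq0 _ _ _ _ d0 (fun x y => (dE x y).1) cs s0).
(* A chain without steps gives [x = y]; any other has at least two points, as (D3) requires. *)
have [[|n] [u [u1 un sE]]] := chain_sum _ _ _ _ cs.
  by apply: xy; rewrite -u1 -un.
have := D3 x y n.+2 u isT u1 un dxy.
by rewrite -sE -lerBlDr leNgt fdelta.
Qed.

Lemma Fopen_chain_from {R : realType} {X : Type} (d : X -> X -> R) x r :
  Fopen d [set z | exists2 s, chain d x z s & s < r].
Proof.
move=> z [s xz sr]; exists (r - s); first by rewrite subr_gt0.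
move=> w; rewrite /Fball /= ltrBrDl => zw.
by exists (s + d z w) => //; exact: chain_rcons.
Qed.

(** Here the new step is put in front of the chain, so it runs from [w] to [z] and symmetry of [d]
    enters. *)
Lemma Fopen_chain_to {R : realType} {X : Type} (d : X -> X -> R) y r :
  (forall x y, d x y = d y x) ->
  Fopen d [set z | exists2 s, chain d z y s & s < r].
Proof.
move=> dC z [s zy sr]; exists (r - s); first by rewrite subr_gt0.
move=> w; rewrite /Fball /= ltrBrDr dC => wz.
by exists (d w z + s) => //; apply: chain_trans zy; exact: chain1.
Qed.

Local Close Scope ring_scope.

Theorem theorem2p1 (R : realType) (X : Type) (d : X -> X -> R)
    (X_nonempty : [set: X] !=set0) (d_Fmetric : is_Fmetric d) :
  hausdorff_space (Fspace d).
Proof.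
have dC : forall x y, d x y = d y x by case: (d_Fmetric) => _ [f [a []]].
rewrite open_hausdorff => x y /eqP xy.
have [delta delta0 lb] := Fmetric_chain_lb d x y d_Fmetric xy.
have r0 : (0 < delta / 2)%R by rewrite divr_gt0.
(* Chains leave [x] but arrive at [y], so that they concatenate at a common point without
   reversal. *)
exists ([set z | exists2 s, chain d x z s & (s < delta / 2)%R],
        [set z | exists2 s, chain d z y s & (s < delta / 2)%R]) => /=.
  by split; rewrite inE; exists 0%R => //; exact: chain_nil.
split; [exact: Fopen_chain_from | exact: Fopen_chain_to |].
apply/eqP; rewrite -subset0 => z [[s xz sr] [t zy tr]].
have := lb _ (chain_trans _ _ _ _ _ _ xz zy).
by rewrite leNgt [delta]splitr ltrD.
Qed.
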